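(* Let $G$ be a graph on $n \ge n_0$ vertices and of average degree $d > 1$, where $n_0$ is a sufficiently large absolute constant. Then $G$ is not $m$-minor-universal for $$m = 6n \frac{\ln(d+2)}{\ln n}.$$
   Context: A graph $H$ is a minor of $G$ if there are disjoint sets $\{W_h \subseteq V(G)\}_{h\in V(H)}$, each inducing a connected subgraph of $G$, with an edge of $G$ between $W_h$ and $W_{h'}$ for every $\{h,h'\}\in E(H)$. A graph $G$ is $m$-minor-universal if it contains every graph with at most $m$ vertices and at most $m$ edges as a minor. Rounding to integers is ignored. *)

(* Defs.v *)
From HB Require Import structures.
From mathcomp Require Import all_boot all_order all_algebra.
From mathcomp Require Import all_classical all_reals all_analysis.

Set Implicit Arguments.
Unset Strict Implicit.
Unset Printing Implicit Defensive.

Import Order.TTheory GRing.Theory Num.Theory.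

Local Open Scope ring_scope.

Record sgraph := SGraph {
  svertex :> finType;
  sedge : rel svertex;
  sedge_sym : symmetric sedge;
  sedge_irrefl : irreflexive sedge
}.

Definition edges (G : sgraph) : {set {set G}} :=
  [set e : {set G} | [exists x : G, exists y : G,
     sedge x y && (e == [set x; y]%SET)]]%SET.

Definition degree (G : sgraph) (x : G) : nat := #|[set y : G | sedge x y]%SET|.

Definition average_degree (R : realType) (G : sgraph) : R :=
  (\sum_(x : G) (degree x)%:R) / #|G|%:R.

(* The subgraph of G induced by W is connected; as usual, a connected graph
   has at least one vertex. *)
Definition induces_connected (G : sgraph) (W : {set G}) : Prop :=
  W != finset.set0 /\
  forall x y : G, x \in W -> y \in W ->
    connect [rel u v : G | [&& u \in W, v \in W & sedge u v]] x y.

Definition minor (H G : sgraph) : Prop :=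
  exists W : H -> {set G},
    [/\ forall h h' : H, h != h' -> [disjoint W h & W h'],
        forall h : H, induces_connected (W h)
      & forall h h' : H, sedge h h' ->
          exists x y : G, [/\ x \in W h, y \in W h' & sedge x y]].

(* The bound m is real: since the numbers of vertices and edges are integers,
   this is minor-universality for the integer part of m. *)
Definition minor_universal (R : realType) (m : R) (G : sgraph) : Prop :=
  forall H : sgraph, #|H|%:R <= m -> #|edges H|%:R <= m -> minor H G.

(* Main.v *)
Require Import Defs.
From HB Require Import structures.
From mathcomp Require Import all_boot all_order all_algebra.
From mathcomp Require Import all_classical all_reals all_analysis.
From mathcomp Require Import lra.

(* Counting labelled graphs. There are k^(2m) lists of m pairs of vertices in
   {1, ..., k}, each giving a graph with k vertices and at most m edges. If all
   of them are minors of G, each list is determined by: a root in every branch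
   set (n^k choices); a spanning forest of the branch sets, given by a map
   sending each vertex to itself or to a neighbour (at most
   prod_v (deg v + 1) <= (d + 1)^n choices, by AM-GM); and, for each of the m
   pairs, an adjacent or equal pair of vertices of G ((d + 1) n choices). Hence
     2 m ln k <= k ln n + n ln (d + 1) + m (ln n + ln (d + 1)),
   which fails for k about n^(3/4) and m about 6 n ln (d + 2) / ln n as long as
   m < n + 1. For larger m the graph with n + 1 vertices and no edge is not a
   minor of G. *)

Set Implicit Arguments.
Unset Strict Implicit.
Unset Printing Implicit Defensive.

Import Order.TTheory GRing.Theory Num.Theory.

Local Open Scope ring_scope.

(** * Rooted forests as parent functions *)

Lemma ex_parent_function (T : finType) (e : rel T) (R : pred T) :
  exists p : T -> T,
    [/\ forall v, p v = v \/ e v (p v), forall v, R v -> p v = v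
      & forall v r, R r -> connect e v r -> exists2 r', R r' & fconnect p v r'].
Proof.
pose near v j := exists q, [/\ path e v q, R (last v q) & (size q <= j)%N].
(* [u] is the next vertex on a shortest path from [v] to [R], or [v] itself if [v] lies in [R] or
   cannot reach it. Shortness lets one [u] serve all [j], so each application of [p] lowers the
   distance to [R]. *)
have step v : exists u, [/\ u = v \/ e v u, R v -> u = v &
    forall j, ~~ R v -> near v j.+1 -> near u j].
  case: (boolP (R v)) => [Rv|nRv]; first by exists v; split=> //; left.
  have [vR|vR] := pselect (exists j, `[< near v j >]); last first.
    exists v; split=> [||j _ vj] //; first by left.
    by case: vR; exists j.+1; apply/asboolP.
  case: (ex_minnP vR) => j0 /asboolP [[|u q] [/= eq Rq sq]] jmin.
    by rewrite Rq in nRv.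
  case/andP: eq => evu eq; exists u; split=> // [|j _ vj]; first by right.
  have /jmin lej : `[< near v j.+1 >] by apply/asboolP.
  by exists q; split=> //; rewrite -ltnS (leq_trans sq).
have [p pP] := fin_all_exists step.
exists p; split=> [v|v|v r Rr /connectP[q eq Er]]; try by case: (pP v).
have: near v (size q) by exists q; rewrite -Er.
move: (size q) => j; move: v {q eq Er}.
elim: j => [|j IH] v vj; case: (boolP (R v)) => [Rv|nRv].
- by exists v => //; apply: connect0.
- by case: vj nRv => -[|? ?] [//= _ ->].
- by exists v => //; apply: connect0.
have [_ _ /(_ j nRv vj)/IH[r' Rr' pr']] := pP v.
by exists r' => //; apply: connect_trans pr'; apply: fconnect1.
Qed.

(** An orbit stays at a fixed point once there, so after the sum of both hitting times the orbit of
    [v] is at [a] and at [b]. *)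
Lemma fconnect_fixed_inj (T : finType) (p : T -> T) (v a b : T) :
  p a = a -> p b = b -> fconnect p v a -> fconnect p v b -> a = b.
Proof.
have fixed c : p c = c -> forall j, iter j p c = c.
  by move=> pc; elim=> //= j ->.
move=> pa pb va vb.
have <- : iter (findex p v b + findex p v a) p v = a.
  by rewrite iterD (iter_findex va) fixed.
by rewrite addnC iterD (iter_findex vb) fixed.
Qed.

(** * Graphs given by lists of vertex pairs *)

Section EdgeListGraph.
Variables (m : nat) (V : finType) (f : {ffun 'I_m -> V * V}).

(** Loops are dropped and repeated pairs merge, so every list gives a simple graph with at most [m]
    edges. *)
Let adj : rel V :=
  [rel x y | (x != y) && [exists i, (f i == (x, y)) || (f i == (y, x))]].

Let adj_sym : symmetric adj.
Proof.
move=> x y; rewrite /adj /= eq_sym; congr andb.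
by apply: eq_existsb => i; rewrite orbC.
Qed.

Let adj_irrefl : irreflexive adj.
Proof. by move=> x; rewrite /adj /= eqxx. Qed.

Definition edge_list_graph : sgraph := SGraph adj_sym adj_irrefl.

Lemma edge_list_graph_sedge (i : 'I_m) :
  (f i).1 != (f i).2 -> @sedge edge_list_graph (f i).1 (f i).2.
Proof.
by move=> nloop; rewrite /= /adj /= nloop; apply/existsP; exists i;
 rewrite -surjective_pairing eqxx.
Qed.

Lemma card_edges_edge_list_graph : (#|edges edge_list_graph| <= m)%N.
Proof.
pose g i : {set V} := [set (f i).1; (f i).2]%SET.
rewrite -[leqRHS]card_ord; apply: leq_trans (leq_imset_card g _).
apply/subset_leq_card/fintype.subsetP => e; rewrite inE.
case/existsP=> x /existsP[y /andP[/andP[_ /existsP[i fi]] /eqP->]].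
apply/imsetP; exists i => //; rewrite /g.
by case/orP: fi => /eqP-> //=; rewrite finset.setUC.
Qed.

End EdgeListGraph.

(* A model of [edge_list_graph f] is encoded by a root in each branch set, a
   parent function on [G] whose iterates lead every vertex of a branch set to
   its root, and for each [i] a pair of vertices in the branch sets of
   [(f i).1] and [(f i).2], which are adjacent unless [f i] is a loop. *)
Lemma minor_code (G : sgraph) (m : nat) (V : finType)
    (f : {ffun 'I_m -> V * V}) :
  minor (edge_list_graph f) G ->
  exists (r : {ffun V -> G}) (p : {ffun G -> G}) (a : {ffun 'I_m -> G * G}),
    [/\ injective r, forall h, p (r h) = r h,
        forall v, p v = v \/ sedge v (p v),
        forall i, (a i).1 = (a i).2 \/ sedge (a i).1 (a i).2
      & forall i, fconnect p (a i).1 (r (f i).1) /\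
                  fconnect p (a i).2 (r (f i).2)].
Proof.
move=> [W [Wdisj Wconn Wedge]].
have Winj v h h' : v \in W h -> v \in W h' -> h = h'.
  move=> vh vh'; apply/eqP; apply: contraT => /Wdisj.
  by move/pred0P/(_ v); rewrite /= vh vh'.
have Wne (h : V) : exists v, v \in W h.
  by have [/finset.set0Pn] := Wconn h.
have [r rW] := fin_all_exists Wne.
have rinj : injective r.
  by move=> h h' eqr; apply: (Winj (r h)); rewrite ?rW // eqr rW.
(* Keeping only edges inside branch sets confines a parent orbit to the branch set where it starts,
   so the root it reaches is the right one. *)
pose e : rel G :=
  [rel u v | [exists h : V, [&& u \in W h, v \in W h & sedge u v]]].
have eW u v h : connect e u v -> u \in W h -> v \in W h.
  move=> /connectP[q]; elim: q u => [|w q IH] u /=; first by move=> _ ->.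
  move=> /andP[/existsP[h' /and3P[uh' wh' _]] eq Ev] uh.
  by apply: (IH w) => //; rewrite (Winj _ _ _ uh uh').
have [p [pe pr pconn]] := ex_parent_function e [pred v | v \in codom r].
have prr h : p (r h) = r h by apply: pr; apply: codom_f.
have conn v h : v \in W h -> fconnect p v (r h).
  move=> vh; have [_ Wc] := Wconn h.
  have evr : connect e v (r h).
    apply: connect_sub (Wc v (r h) vh (rW h)) => x y /= xy.
    by apply: connect1; apply/existsP; exists h.
  have [_ /codomP[h' ->] vr] := pconn v (r h) (codom_f r h) evr.
  suff -> : h = h' by [].
  apply: Winj (rW h'); apply: (eW v) => //.
  apply: connect_sub vr => x y /= /eqP <-.
  by case: (pe x) => [->|]; [apply: connect0 | apply: connect1].
have pairs i : exists a : G * G,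
    [/\ a.1 \in W (f i).1, a.2 \in W (f i).2 & a.1 = a.2 \/ sedge a.1 a.2].
  have [eqf|/edge_list_graph_sedge/Wedge[x [y [xW yW xy]]]] :=
      eqVneq (f i).1 (f i).2.
    by exists (r (f i).1, r (f i).1); rewrite -eqf; split; rewrite ?rW //; left.
  by exists (x, y); split=> //; right.
have [a aP] := fin_all_exists pairs.
exists (finfun r), (finfun p), (finfun a); split.
- by move=> h h'; rewrite !ffunE; apply: rinj.
- by move=> h; rewrite !ffunE.
- move=> v; rewrite ffunE; case: (pe v) => [|/existsP[h /and3P[]]]; first by left.
  by right.
- by move=> i; rewrite !ffunE; have [] := aP i.
- move=> i; rewrite !ffunE; have [a1 a2 _] := aP i.
  by rewrite !(eq_fconnect (ffunE p)); split; apply: conn.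
Qed.

(** * Counting codes *)

Lemma card_closed_nbhd (G : sgraph) (v : G) :
  #|[pred u | (u == v) || sedge v u]| = (degree v).+1.
Proof.
rewrite /degree; have := cardU1 v [set u | sedge v u]%SET; rewrite inE sedge_irrefl add1n => <-.
by apply: eq_card => u; rewrite !inE.
Qed.

(** [decode] maps the set [C] of codes onto all lists. [C] forgets that roots are distinct and
    fixed, which makes it a product and easy to count. *)
Lemma universal_count (G : sgraph) (m k : nat) :
  (forall f : {ffun 'I_m -> 'I_k.+1 * 'I_k.+1}, minor (edge_list_graph f) G) ->
  (k.+1 ^ (2 * m) <= #|G| ^ k.+1 * \prod_(v : G) (degree v).+1 *
                     (\sum_(v : G) (degree v).+1) ^ m)%N.
Proof.
move=> allminor; pose V := 'I_k.+1.
pose nbhd (v : G) := [pred u | (u == v) || sedge v u].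
pose P := [set p : {ffun G -> G} | p \in family nbhd]%SET.
pose A := [set x : G * G | x.2 \in nbhd x.1]%SET.
pose E := [set a : {ffun 'I_m -> G * G} | a \in ffun_on (mem A)]%SET.
pose C := finset.setX (finset.setX [set: {ffun V -> G}]%SET P) E.
(* [ord0] is the value when the orbit of [v] meets no root; it exists because the vertex set has
   size [k.+1]. *)
pose root (r : {ffun V -> G}) (p : {ffun G -> G}) v :=
  odflt ord0 [pick h | fconnect p v (r h)].
pose decode (c : {ffun V -> G} * {ffun G -> G} * {ffun 'I_m -> G * G}) :
    {ffun 'I_m -> V * V} :=
  [ffun i => (root c.1.1 c.1.2 (c.2 i).1, root c.1.1 c.1.2 (c.2 i).2)].
have decode_onto : [set: {ffun 'I_m -> V * V}]%SET \subset (decode @: C)%SET.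
  apply/fintype.subsetP => f _.
  have [r [p [a [rinj pr pP aP fa]]]] := minor_code (allminor f).
  apply/imsetP; exists (r, p, a).
    rewrite !finset.in_setX finset.in_setT !finset.in_set /=; apply/andP; split.
      by apply/familyP => v; rewrite inE; case: (pP v) => ->; rewrite ?eqxx ?orbT.
    apply/ffun_onP => i; rewrite !inE.
    by case: (aP i) => ->; rewrite ?eqxx ?orbT.
  have rootE v h : fconnect p v (r h) -> root r p v = h.
    move=> vh; rewrite /root; case: pickP => [h' vh'|/(_ h)]; last by rewrite vh.
    by apply: rinj; apply: fconnect_fixed_inj (pr _) (pr _) vh' vh.
  apply/ffunP => i; rewrite ffunE /= [LHS]surjective_pairing.
  by have [f1 f2] := fa i; rewrite (rootE _ _ f1) (rootE _ _ f2).
have cardP : #|P| = (\prod_(v : G) (degree v).+1)%N.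
  rewrite cardsE card_family foldrE big_map big_enum /=.
  by apply: eq_bigr => v _; rewrite card_closed_nbhd.
have cardA : #|A| = (\sum_(v : G) (degree v).+1)%N.
  rewrite -sum1_card (eq_bigl (fun x => true && (x.2 \in nbhd x.1))); last first.
    by move=> x; rewrite inE.
  rewrite -(pair_big_dep xpredT (fun v u => u \in nbhd v) (fun _ _ => 1%N)) /=.
  by apply: eq_bigr => v _; rewrite sum1_card card_closed_nbhd.
have := leq_trans (subset_leq_card decode_onto) (leq_imset_card decode (mem C)).
rewrite !finset.cardsX !cardsT !card_ffun card_prod !card_ord cardP.
by rewrite mulnn -expnM cardsE card_ffun_on card_ord cardA.
Qed.

(** * The count in logarithms and its contradiction *)

Section LogCount.
Variables (R : realType) (G : sgraph).
Local Notation n := (#|G|%:R : R).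
Local Notation d := (average_degree R G).

Lemma sum_degreeS : (0 < #|G|)%N ->
  (\sum_(v : G) (degree v).+1)%:R = n * (d + 1) :> R.
Proof.
move=> G0; rewrite mulrDr mulr1 /average_degree mulrCA divff ?mulr1; last first.
  by rewrite pnatr_eq0 -lt0n.
under eq_bigr do rewrite -addn1.
by rewrite big_split /= sum1_card natrD natr_sum.
Qed.

Lemma prod_degreeS_le : (0 < #|G|)%N ->
  (\prod_(v : G) (degree v).+1)%:R <= (d + 1) ^+ #|G| :> R.
Proof.
move=> G0; have n0 : n != 0 by rewrite pnatr_eq0 -lt0n.
have -> : d + 1 = (\sum_(v in G) (degree v).+1%:R) / n.
  by rewrite -natr_sum sum_degreeS // mulrC mulKf.
rewrite natr_prod.
by have [] := @leif_AGM R G (mem G) (fun v => (degree v).+1%:R) (fun _ _ => ler0n _ _).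
Qed.

Lemma universal_count_ln (m k : nat) : (0 < #|G|)%N ->
  (forall f : {ffun 'I_m -> 'I_k.+1 * 'I_k.+1}, minor (edge_list_graph f) G) ->
  2 * m%:R * ln (k.+1%:R : R) <=
    k.+1%:R * ln n + n * ln (d + 1) + m%:R * (ln n + ln (d + 1)).
Proof.
move=> G0 /universal_count; rewrite -(ler_nat R) => count.
have n0 : 0 < n by rewrite ltr0n.
have d0 : 0 < d + 1.
  by rewrite ltr_wpDl // divr_ge0 // ?sumr_ge0 // => v _; rewrite ler0n.
have {}count : k.+1%:R ^+ (2 * m) <=
    n ^+ k.+1 * (d + 1) ^+ #|G| * (n * (d + 1)) ^+ m.
  rewrite -natrX (le_trans count) // !natrM !natrX sum_degreeS //.
  rewrite ler_wpM2r ?exprn_ge0 ?mulr_ge0 ?(ltW n0) ?(ltW d0) //.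
  by rewrite ler_wpM2l ?exprn_ge0 ?ler0n // prod_degreeS_le.
have nd0 : 0 < n * (d + 1) by rewrite mulr_gt0.
have k0 : 0 < k.+1%:R :> R by rewrite ltr0n.
have pow0 (x : R) j : 0 < x -> x ^+ j \is Num.pos by rewrite posrE; apply: exprn_gt0.
rewrite -ler_ln ?rpredM ?pow0 // in count.
rewrite lnM ?rpredM ?pow0 // lnM ?pow0 // !lnXn // lnM ?posrE // in count.
by move: count; rewrite -!(mulr_natl (ln _)) -(mulr_natl (_ + _)) natrM.
Qed.

End LogCount.

(* Read [n = #|G|], [L = ln n], [D = ln (d + 2)], [D' = ln (d + 1)], and [M] the
   bound of the theorem; [K >= n^(3/4)] is the number of vertices of the minors
   and [m] their number of edges. The parameter [t = n^(1/8)] turns [L << n]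
   into the polynomial bound [L <= 8 t]. *)
Lemma count_contradiction (R : realType) (t n L D D' M m K lnK : R) :
  26 <= t -> n = t ^+ 8 -> 0 < L -> L <= 8 * t -> K <= t ^+ 6 + 1 ->
  3 / 4 * L <= lnK -> M * L = 6 * n * D -> M <= n + 1 -> m <= M -> M < m + 1 ->
  0 <= m -> 2 / 3 <= D -> D' <= D ->
  2 * m * lnK <= K * L + n * D' + m * (L + D') -> False.
Proof.
move=> t26 En L0 Lt Kt lnKL ML Mn mM Mm m0 D23 D'D count.
pose s := t ^+ 6.
have s26 : 26 <= s.
  rewrite (le_trans t26) // /s -[leLHS]expr1 ler_weXn2l //; lra.
have st : 26 * t <= t * s by rewrite mulrC ler_wpM2l //; lra.
have nE : n = t * (t * s) by rewrite En /s -!exprS.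
have n26 : 26 * (t * s) <= n by rewrite nE ler_wpM2r ?mulr_ge0 //; lra.
have n5 : 5 <= n by lra.
(* [M <= n + 1] forces 6 n D <= (n + 1) L, and (n + 1) / 6 <= n / 5 since n >= 5. *)
have DL : D <= L / 5.
  have : n * (6 * D) <= n * (6 / 5 * L).
    have ML' : M * L <= (n + 1) * L by rewrite ler_wpM2r // ltW.
    have nL : 5 * L <= n * L by rewrite ler_wpM2r // ltW.
    clear - ML ML' nL; lra.
  rewrite ler_pM2l; lra.
have mD : m * D' <= m * (L / 5) by rewrite ler_wpM2l //; lra.
have nD : n * D' <= n * D by rewrite ler_wpM2l //; lra.
have mK : m * (3 / 4 * L) <= m * lnK by rewrite ler_wpM2l.
have mL : (M - 1) * L <= m * L by rewrite ler_wpM2r; lra.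
(* In [count], [m] has net coefficient at least (3/2 - 1 - 1/5) L = 3/10 L. With m >= M - 1 and M L
   = 6 n D this yields 9/5 n D <= (K + 3/10) L + n D. *)
have KL : (K + 3 / 10) * L <= (s + 13 / 10) * (8 * t).
  have Ks : K <= s + 1 by [].
  apply: (@le_trans _ _ ((s + 13 / 10) * L)).
    by rewrite ler_wpM2r; lra.
  by rewrite ler_wpM2l; lra.
have nD' : n * (2 / 3) <= n * D by rewrite ler_wpM2l //; lra.
(* Hence 8/15 n <= 4/5 n D <= 8 t (s + 13/10) < 9 t s, against [n26]. *)
lra.
Qed.

Theorem theorem1p5 (R : realType) :
  exists n0 : nat, forall (G : sgraph) (n : nat) (d : R),
    #|G| = n -> (n0 <= n)%N ->
    average_degree R G = d -> 1 < d ->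
    ~ minor_universal (6 * n%:R * (ln (d + 2) / ln n%:R)) G.
Proof.
(* L > 200 gives t = exp (L / 8) >= 1 + 25, the 26 of [count_contradiction]. *)
exists (Num.trunc (expR 200 : R)).+1 => G n d Gn n0n Gd d1.
set M := (X in minor_universal X _) => univ.
have n_gt : expR 200 < n%:R :> R.
  by rewrite (lt_le_trans (truncnS_gt _)) // ler_nat.
have n_gt0 : 0 < n%:R :> R by rewrite (lt_trans _ n_gt) // expR_gt0.
set L := ln (n%:R : R) in M univ.
have L200 : 200 < L by rewrite -[200]expRK ltr_ln ?posrE ?expR_gt0.
have L0 : 0 < L by lra.
pose t := expR (L / 8).
have t0 : 0 < t by apply: expR_gt0.
have t26 : 26 <= t by apply: le_trans (expR_ge1Dx _); lra.
have lnt : ln t = L / 8 by rewrite /t expRK.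
have Lt : L <= 8 * t by have := ln_sublinear t0; lra.
have nt : n%:R = t ^+ 8 :> R.
  by rewrite /t -expRM_natr divfK ?pnatr_eq0 // lnK ?posrE.
(* ln (d + 2) >= ln 3 = - ln (1/3), and ln (1 + x) <= x at x = -2/3. *)
have D23 : 2 / 3 <= ln (d + 2).
  have : ln (3^-1) <= ln (1 + - (2 / 3)) :> R by rewrite ler_ln ?posrE; lra.
  have : ln (1 + - (2 / 3)) <= - (2 / 3) :> R by apply: le_ln1Dx; lra.
  have : ln 3 <= ln (d + 2) by rewrite ler_ln ?posrE; lra.
  rewrite lnV ?posrE; lra.
have D'D : ln (d + 1) <= ln (d + 2) by rewrite ler_ln ?posrE; lra.
have ML : M * L = 6 * n%:R * ln (d + 2).
  by rewrite /M -mulrA divfK // lt0r_neq0.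
have M0 : 0 <= M.
  by rewrite !mulr_ge0 ?invr_ge0 ?(ltW L0) //; lra.
have [nM|Mn] := leP (n%:R + 1) M.
  pose f : {ffun 'I_0 -> 'I_n.+1 * 'I_n.+1} := [ffun=> (ord0, ord0)].
  have [||r [_ [_ [rinj _ _ _ _]]]] := minor_code (univ (edge_list_graph f) _ _).
  - by rewrite card_ord -natr1.
  - by rewrite (le_trans _ M0) // lern0 -leqn0 card_edges_edge_list_graph.
  by have := leq_card r rinj; rewrite card_ord Gn ltnn.
pose m := Num.trunc M; pose k := Num.trunc (t ^+ 6).
have t60 : 0 <= t ^+ 6 by rewrite exprn_ge0 ?ltW.
have /andP[k_le k_gt] := truncn_itv t60.
have /andP[m_le m_gt] := truncn_itv M0.
rewrite -/k -/m in k_le k_gt m_le m_gt.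
(* Universality only covers graphs with at most M vertices. Here (t^6 + 1) L <= 16 t^7, while M L >=
   4 t^8 >= 104 t^7. *)
have kM : k.+1%:R <= M.
  rewrite -natr1 (le_trans (lerD k_le (lexx 1))) //.
  rewrite -(ler_pM2r L0) ML nt.
  have t61 : 1 <= t ^+ 6 by rewrite exprn_ege1 //; lra.
  have : t ^+ 8 * (2 / 3) <= t ^+ 8 * ln (d + 2).
    by apply: ler_wpM2l => //; apply: exprn_ge0; apply: ltW.
  have : (t ^+ 6 + 1) * L <= (t ^+ 6 + t ^+ 6) * (8 * t).
    by apply: ler_pM => //; lra.
  have : 26 * (t * t ^+ 6) <= t ^+ 8.
    by rewrite -exprS [t ^+ 8]exprS ler_wpM2r // exprn_ge0 // ltW.
  have : 0 <= t * t ^+ 6 by rewrite mulr_ge0 // ltW.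
  lra.
have G0 : (0 < #|G|)%N by rewrite Gn -(ltr0n R).
have minors (f : {ffun 'I_m -> 'I_k.+1 * 'I_k.+1}) : minor (edge_list_graph f) G.
  apply: univ; first by rewrite card_ord.
  by rewrite (le_trans _ m_le) // ler_nat card_edges_edge_list_graph.
have := universal_count_ln R G0 minors; rewrite Gn Gd -/L.
apply: (count_contradiction (t := t) (M := M) (D := ln (d + 2))) => //.
- by rewrite -natr1 lerD2r.
- have <- : ln (t ^+ 6) = 3 / 4 * L by rewrite lnXn // lnt -mulr_natl; lra.
  by rewrite ler_ln ?posrE ?exprn_gt0 ?ltr0n // ltW.
- exact: ltW.
- by rewrite natr1.
Qed.
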